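(* Let $G=(V,E)$ be a connected graph with maximum degree $\Delta$ and let $S\subsetneq V$ be a set of vertices such that the induced subgraph on $S$ is connected and $\lambda_1(\tilde A_S)>0$. Let $\psi_S$ be the $\ell_2$-normalized Perron vector of $\tilde A_S$. Then there is a vertex $u\in S$ which is adjacent to $V\setminus S$ such that $$\psi_S(u)\ \ge\ \frac{1}{\Delta^{5/2}\,\lambda_1(\tilde A_S)\,|S|^{5/2}}.$$
   Context: Graphs are finite, undirected, and may have multiedges and self-loops. $A$ is the adjacency matrix of $G$, $D$ the diagonal matrix of degrees in $G$ (row sums of $A$; each self-loop contributes one), and $\tilde A=D^{-1/2}AD^{-1/2}$. $\tilde A_S$ is the principal submatrix of $\tilde A$ with rows and columns indexed by $S$ (degrees are taken in $G$, not in the induced subgraph), $\lambda_1(\tilde A_S)$ is its largest eigenvalue, and the Perron vector $\psi_S$ is the unique strictly positive unit eigenvector of $\tilde A_S$ for $\lambda_1(\tilde A_S)$. *)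

(* Defs.v *)
From HB Require Import structures.
From mathcomp Require Import all_boot all_order all_algebra.
From mathcomp Require Import all_classical all_reals all_analysis.

Set Implicit Arguments.
Unset Strict Implicit.
Unset Printing Implicit Defensive.

Import Order.TTheory GRing.Theory Num.Theory.
Local Open Scope ring_scope.

(* Finite undirected graphs with multiedges and self-loops.  The pair [ends e]
   is only a presentation of the unordered pair of endpoints of [e]: all the
   notions below are insensitive to the order of its components. *)
Record multigraph (V : finType) := Multigraph {
  edge : finType;
  ends : edge -> V * V
}.

(* Number of edges joining [u] and [v]; a self-loop at [u] counts once in
   [mult G u u]. *)
Definition mult (V : finType) (G : multigraph V) (u v : V) : nat :=
  #|[set e : edge G | (ends e == (u, v)) || (ends e == (v, u))]|.

Definition adj (V : finType) (G : multigraph V) : rel V :=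
  [rel u v | (0 < mult G u v)%N].

Definition degree (V : finType) (G : multigraph V) (v : V) : nat :=
  (\sum_(w : V) mult G v w)%N.

Definition max_degree (V : finType) (G : multigraph V) : nat :=
  (\max_(v : V) degree G v)%N.

Definition induced_connected (V : finType) (G : multigraph V) (S : {set V}) :
    Prop :=
  S != finset.set0 /\
  {in S &, forall u v, connect [rel x y in S | adj G x y] u v}.

Definition connected_graph (V : finType) (G : multigraph V) : Prop :=
  induced_connected G [set: V]%SET.

(* Matrices indexed by V are matrices over 'I_#|V|, through the bijections
   [enum_val : 'I_#|V| -> V] and [enum_rank : V -> 'I_#|V|]. *)
Definition adjmx (R : realType) (V : finType) (G : multigraph V) :
    'M[R]_#|V| :=
  \matrix_(i, j) (mult G (enum_val i) (enum_val j))%:R.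

(* D^{-1/2} *)
Definition inv_sqrt_degmx (R : realType) (V : finType) (G : multigraph V) :
    'M[R]_#|V| :=
  diag_mx (\row_i (Num.sqrt (degree G (enum_val i))%:R)^-1).

Definition normadjmx (R : realType) (V : finType) (G : multigraph V) :
    'M[R]_#|V| :=
  inv_sqrt_degmx R G *m adjmx R G *m inv_sqrt_degmx R G.

(* Principal submatrix with rows and columns in S; the i-th one is that of the
   i-th element of [enum S]. *)
Definition principal_submx (R : realType) (V : finType) (M : 'M[R]_#|V|)
    (S : {set V}) : 'M[R]_#|S| :=
  let f (i : 'I_#|S|) : 'I_#|V| := enum_rank (enum_val i) in mxsub f f M.

Definition largest_eigenvalue (R : realType) (n : nat) (M : 'M[R]_n) (a : R) :
    Prop :=
  eigenvalue M a /\ forall b : R, eigenvalue M b -> b <= a.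

Definition perron_vector (R : realType) (n : nat) (M : 'M[R]_n)
    (psi : 'cV[R]_n) : Prop :=
  [/\ forall i, 0 < psi i 0,
      Num.sqrt (\sum_i psi i 0 ^+ 2) = 1
    & exists2 a : R, largest_eigenvalue M a & M *m psi = a *: psi].

(* Main.v *)
(** Put [f = D^{-1/2} psi_S], so that
[lambda d(u) f(u) = \sum_(v in S) A(u,v) f(v)] on [S], and write [B] for the set of vertices of [S] with a neighbour outside
[S], [k = |S|], [M = max_S f] and [m = max_B f].  Summing the equation over [S]
gives [(1 - lambda) \sum_S d f <= Delta |B| m].  Testing it against [f], and
keeping only the energy of [f] along a path of length [L <= k - |B|] in [S] from
the maximum of [f] to [B], gives
[(M - m)^2 <= L (1 - lambda) \sum_S d f^2 <= L (1 - lambda) M \sum_S d f].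
Hence [(M - m)^2 <= M m Delta L |B| <= M m Delta k^2 / 4], so that
[M <= Delta k^2 m].  One concludes with [1 = \sum_S d f^2 <= Delta k M^2],
[psi >= f] and [1 <= lambda Delta], the last by the equation at the minimum of
[f]. *)

Require Import Defs.
From HB Require Import structures.
From mathcomp Require Import all_boot all_order all_algebra.
From mathcomp Require Import all_classical all_reals all_analysis.
From mathcomp Require Import ring lra.

Set Implicit Arguments.
Unset Strict Implicit.
Unset Printing Implicit Defensive.

Import Order.TTheory GRing.Theory Num.Theory.
Local Open Scope ring_scope.

(** * Dirichlet energy: a lower bound along a path, and summation by parts *)

(** Cauchy-Schwarz along the path; the 2 is there because the double sum meets each edge of the path
    in both orders. The induction removes [x] from [D]: the path is simple, so its remainder stays
    in the smaller set. *)
Lemma dirichlet_energy_path (R : realFieldType) (T : finType)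
    (A : T -> T -> R) (e : rel T) (f : T -> R) (D : {set T}) (x : T)
    (p : seq T) :
  (forall u v, 0 <= A u v) ->
  (forall u v, e u v -> 1 <= A u v) ->
  symmetric e ->
  path e x p -> uniq (x :: p) -> {subset x :: p <= D} ->
  2 * (f x - f (last x p)) ^+ 2 <=
    (size p)%:R * \sum_(u in D) \sum_(v in D) A u v * (f u - f v) ^+ 2.
Proof.
move=> A0 A1 esym; pose F u v := A u v * (f u - f v) ^+ 2.
have F0 u v : 0 <= F u v by rewrite mulr_ge0 ?sqr_ge0.
elim: p x D => [|y p IHp] x D /=.
  by move=> _ _ _; rewrite subrr expr0n mulr0 mul0r.
move=> /andP[exy pyp] /andP[xNyp uyp] sD.
have xD : x \in D by apply: sD; rewrite mem_head.
have yD : y \in (D :\ x)%SET.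
  rewrite !inE sD ?inE ?eqxx ?orbT // andbT.
  by apply: contraNneq xNyp => ->; rewrite mem_head.
have {IHp} IH := IHp y (D :\ x)%SET pyp uyp.
have /IH {}IH : {subset y :: p <= (D :\ x)%SET}.
  move=> z zyp; rewrite !inE sD ?andbT; last by rewrite inE zyp orbT.
  by apply: contraNneq xNyp => <-.
set E' := (X in _ <= _ * X) in IH.
have E'0 : 0 <= E' by do 2![apply: sumr_ge0 => ? _]; apply: F0.
(* Of the terms lost with [x], only those at [(x, y)] and [(y, x)] are kept. *)
have EE' : E' + 2 * (f x - f y) ^+ 2 <=
    \sum_(u in D) \sum_(v in D) A u v * (f u - f v) ^+ 2.
  rewrite (big_setD1 x xD) /=.
  under [X in _ <= _ + X]eq_bigr do rewrite (big_setD1 x xD) /=.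
  rewrite big_split /= -/E' addrA [leRHS]addrC lerD2l.
  have -> : 2 * (f x - f y) ^+ 2 = (f x - f y) ^+ 2 + (f y - f x) ^+ 2 by ring.
  apply: lerD.
    have := fintype.subsetP (subD1set D x) y yD => yD'.
    rewrite (big_setD1 y yD') /= -[leLHS]addr0 lerD ?sumr_ge0 // => [|u _].
      by rewrite ler_peMl ?sqr_ge0 // A1.
    exact: F0.
  rewrite (big_setD1 y yD) /= -[leLHS]addr0 lerD ?sumr_ge0 // => [|u _].
    by rewrite ler_peMl ?sqr_ge0 // A1 // esym.
  exact: F0.
have n0 : 0 <= (size p)%:R :> R by [].
apply: le_trans (_ : (size p).+1%:R * (E' + 2 * (f x - f y) ^+ 2) <= _);
  last first.
  by rewrite ler_wpM2l.
rewrite -(natr1 (size p)).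
have -> : f x - f (last y p) = (f x - f y) + (f y - f (last y p)) by ring.
(* For $k > 0$, $(a+b)^2 \le (k+1)(a^2 + b^2/k)$: multiplied by $k$, the two sides differ by
   $(ka-b)^2$. The case $k = 0$ has to be treated apart. *)
have [/size0nil -> /=|] := posnP (size p); first by rewrite subrr; lra.
rewrite -(ltr0n R) => k0; move: IH E'0 k0 {n0 EE'}.
move: (f x - f y) (f y - f _) E' (size p)%:R => a b E k bE E0 k0.
rewrite -(ler_pM2l k0); have := ler_wpM2l (ltW k0) bE.
by have := sqr_ge0 (k * a - b); nra.
Qed.

(** The square is $f(u)(f(u)-f(v)) + f(v)(f(v)-f(u))$, and by symmetry of [A] both halves have the
    same sum. *)
Lemma sum_dirichlet (R : realFieldType) (T : finType) (A : T -> T -> R)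
    (f : T -> R) (D : {set T}) :
  (forall u v, A u v = A v u) ->
  \sum_(u in D) \sum_(v in D) A u v * (f u - f v) ^+ 2 =
    2 * \sum_(u in D) f u * \sum_(v in D) A u v * (f u - f v).
Proof.
move=> Asym; rewrite mulr_natl mulr2n.
under [X in _ = _ + X]eq_bigr do rewrite mulr_sumr.
rewrite [X in _ = _ + X]exchange_big /= -big_split /=; apply: eq_bigr => u _.
rewrite mulr_sumr -big_split /=; apply: eq_bigr => v _.
by rewrite (Asym v u); ring.
Qed.

(** Cut a simple path at its first vertex in [B]. As the earlier vertices avoid [B], the length is
    at most the number of available vertices outside [B]. *)
Lemma first_hit_path (T : finType) (e : rel T) (B : {set T}) (x y : T) :
  connect e x y -> y \in B ->
  exists p, [/\ path e x p, uniq (x :: p), last x p \in B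
    & ~~ has [in B] (belast x p)].
Proof.
case/connectP => p; case/shortenP => q xq uq _ -> yB {p}.
have [s sE] : exists s, s = x :: q by exists (x :: q).
have hs : has [in B] s by apply/hasP; exists (last x q); rewrite // sE mem_last.
case: (split_find hs) sE => b s1 s2 bB NB {s hs}.
case: s1 NB => [|z s1] NB /= [zx].
  by move=> _; exists [::]; rewrite /= -zx.
subst z => qE; exists (rcons s1 b); move: xq uq.
rewrite -qE cat_path -cat_cons cat_uniq last_rcons belast_rcons.
by case/andP=> -> _ /and3P[uq _ _]; split.
Qed.

(** * Edges leaving [S] and the inner boundary *)

Lemma mult_sym (V : finType) (G : multigraph V) (u v : V) :
  mult G u v = mult G v u.
Proof. by apply: eq_card => e; rewrite !inE orbC. Qed.

Definition inner_boundary (V : finType) (G : multigraph V) (S : {set V}) :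
    {set V} :=
  [set u in S | [exists v, (v \notin S) && adj G u v]]%SET.

(** On a path of [G] from [S] to its complement, the first edge that leaves [S] starts in the
    boundary. *)
Lemma inner_boundary_neq0 (V : finType) (G : multigraph V) (S : {set V}) :
  connected_graph G -> S \proper [set: V]%SET -> S != finset.set0 ->
  exists u, u \in inner_boundary G S.
Proof.
move=> [_ Gc] /properP[_ [t _ tS]] /set0Pn[s sS].
have /connectP[p + tE] := Gc s t (finset.in_setT _) (finset.in_setT _).
elim: p s sS tE => [|y p IHp] s sS /= tE; first by rewrite tE sS in tS.
case/andP=> /andP[_ sy]; case: (boolP (y \in S)) => [yS|yS _].
  exact: IHp.
by exists s; rewrite inE sS; apply/existsP; exists y; rewrite yS.
Qed.

Lemma degreeID (V : finType) (G : multigraph V) (S : {set V}) (u : V) :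
  degree G u =
    (\sum_(v in S) mult G u v + \sum_(v | v \notin S) mult G u v)%N.
Proof. by rewrite /degree (bigID [in S]). Qed.

Lemma degree_interior (V : finType) (G : multigraph V) (S : {set V}) (u : V) :
  u \in S -> u \notin inner_boundary G S ->
  degree G u = (\sum_(v in S) mult G u v)%N.
Proof.
move=> uS; rewrite (degreeID G S) inE uS negb_exists /= => /forallP uN.
rewrite [X in (_ + X)%N]big1 ?addn0 // => v vS.
by have := uN v; rewrite vS -leqNgt leqn0 => /eqP.
Qed.

(** * The maximum on [S] against the maximum on the inner boundary *)

(** Meant for $f = D^{-1/2}\psi_S$, whose equation involves [mult] and [degree] without square
    roots. The vertex found is a maximum point of [f] on the boundary. *)
Lemma eigenfunction_boundary_max (R : realFieldType) (V : finType)
    (G : multigraph V) (S : {set V}) (lambda : R) (f : V -> R) :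
  connected_graph G -> S \proper [set: V]%SET -> induced_connected G S ->
  (forall u, u \in S -> 0 < f u) ->
  (forall u, u \in S -> lambda * (degree G u)%:R * f u =
     \sum_(v in S) (mult G u v)%:R * f v) ->
  exists2 u, u \in inner_boundary G S &
    forall w, w \in S ->
      f w <= (max_degree G)%:R * #|S|%:R ^+ 2 * f u.
Proof.
move=> Gc Sp [S0 Sc] fpos fE.
have [u0 u0B] := inner_boundary_neq0 Gc Sp S0.
set B := inner_boundary G S in u0B *.
have BS : B \subset S by apply/fintype.subsetP => u; rewrite inE => /andP[].
have u0S := fintype.subsetP BS u0 u0B.
case: (arg_maxP f u0B) => u uB umax; exists u => // x xS.
case: (arg_maxP f u0S) => w wS wmax; apply: le_trans (wmax x xS) _ => {x xS}.
have uS := fintype.subsetP BS u uB.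
set m := f u in umax *; set M := f w in wmax *.
have {}umax x : x \in B -> f x <= m by exact: umax.
have {}wmax x : x \in S -> f x <= M by exact: wmax.
have m0 : 0 < m by apply: fpos.
have mM : m <= M by apply: wmax.
set d := fun v => (degree G v)%:R : R.
set dS := fun v => (\sum_(x in S) mult G v x)%:R : R.
set De := (max_degree G)%:R : R.
have d0 v : 0 <= d v by [].
have dSd v : dS v <= d v by rewrite ler_nat (degreeID G S) leq_addr.
have dDe v : d v <= De by rewrite ler_nat (leq_bigmax v).
have du0 : 1 <= d u0.
  move: u0B; rewrite inE u0S => /existsP[v /andP[_ u0v]].
  by rewrite ler1n (leq_trans u0v) // /degree (bigD1 v) //= leq_addr.
have De1 : 1 <= De := le_trans du0 (dDe u0).
have sdf : 0 < \sum_(v in S) d v * f v.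
  rewrite (bigD1 u0) //= ltr_pwDl //.
    by rewrite mulr_gt0 ?fpos // (lt_le_trans _ du0).
  by apply: sumr_ge0 => v /andP[vS _]; rewrite mulr_ge0 // ltW // fpos.
(* Sum the equation over [S] and exchange the sums; [d v - dS v] counts the edges from [v] that
   leave [S]. *)
have flux : (1 - lambda) * \sum_(v in S) d v * f v =
    \sum_(v in S) (d v - dS v) * f v.
  have symm : \sum_(v in S) lambda * d v * f v = \sum_(v in S) dS v * f v.
    under eq_bigr => v vS do rewrite fE //.
    rewrite exchange_big /=; apply: eq_bigr => v vS.
    rewrite -mulr_suml /dS natr_sum; congr (_ * _).
    by apply: eq_bigr => y _; rewrite mult_sym.
  under [in RHS]eq_bigr do rewrite mulrBl.
  rewrite sumrB -symm mulrBl mul1r mulr_sumr; congr (_ - _).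
  by apply: eq_bigr => v _; rewrite mulrA.
have fluxle : (1 - lambda) * \sum_(v in S) d v * f v <= De * #|B|%:R * m.
  rewrite flux (big_setID B) /= (finset.setIidPr BS) [X in _ + X]big1 ?addr0.
    rewrite mulrAC -sum1_card natr_sum mulr_sumr; apply: ler_sum => v vB.
    rewrite mulr1 ler_pM ?subr_ge0 ?dSd //; last exact: umax.
      by rewrite ltW // fpos // (fintype.subsetP BS).
    by rewrite (le_trans _ (dDe v)) // gerBl.
  move=> v; rewrite inE => /andP[vB vS].
  by rewrite /d /dS (degree_interior vS vB) subrr mul0r.
have lam1 : 0 <= 1 - lambda.
  rewrite -(pmulr_lge0 _ sdf) flux sumr_ge0 // => v vS.
  by rewrite mulr_ge0 ?subr_ge0 ?dSd // ltW // fpos.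
pose A x y : R := (mult G x y)%:R.
(* Summation by parts leaves $\sum_S (dS - \lambda d) f^2$; then [dS <= d], and one factor [f] is
   bounded by [M]. *)
have energy : \sum_(x in S) \sum_(y in S) A x y * (f x - f y) ^+ 2 <=
    2 * ((1 - lambda) * (M * \sum_(v in S) d v * f v)).
  rewrite sum_dirichlet; last by move=> x y; rewrite /A mult_sym.
  rewrite ler_wpM2l // 2!mulr_sumr; apply: ler_sum => v vS.
  have -> : \sum_(y in S) A v y * (f v - f y) = (dS v - lambda * d v) * f v.
    under eq_bigr do rewrite mulrBr.
    by rewrite sumrB -fE // -mulr_suml -natr_sum mulrBl.
  have fv := fpos v vS.
  have h1 : (dS v - lambda * d v) * f v <= (1 - lambda) * d v * f v.
    rewrite ler_pM2r // mulrBl mul1r lerD2r; exact: dSd.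
  apply: le_trans (_ : f v * ((1 - lambda) * d v * f v) <= _).
    by rewrite ler_pM2l.
  have -> : f v * ((1 - lambda) * d v * f v) =
      (1 - lambda) * (f v * (d v * f v)).
    by ring.
  by rewrite ler_wpM2l // ler_wpM2r ?mulr_ge0 // ?wmax ?(ltW fv).
have k1 : 1 <= #|S|%:R :> R by rewrite ler1n card_gt0.
have [wB|wB] := boolP (w \in B).
  apply: le_trans (umax w wB) _.
  by rewrite ler_peMl ?(ltW m0) // mulr_ege1 // exprn_ege1.
have [p [wp up lp NB]] := first_hit_path (Sc w u wS uS) uB.
have pS : {subset w :: p <= S}.
  elim: (p) (w) wS wp => [|y q IHq] z zS /=.
    by move=> _ v; rewrite inE => /eqP->.
  case/andP=> /andP[/andP[_ yS] _] yq v; rewrite inE => /predU1P[->//|].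
  exact: IHq.
(* The vertices of the path other than its last are distinct and lie in [S] minus [B]. *)
have size_p : (size p + #|B| <= #|S|)%N.
  move: up; rewrite lastI rcons_uniq => /andP[_ ub].
  rewrite -(size_belast w p) -(card_uniqP ub).
  rewrite -(cardsID B S) (finset.setIidPr BS) addnC leq_add2l.
  apply/subset_leq_card/fintype.subsetP => v vb; rewrite inE.
  by rewrite (hasPn NB) // pS // lastI mem_rcons inE vb orbT.
have p_gt0 : (0 < size p)%N.
  by case: (p) lp => //= wB'; rewrite wB' in wB.
have B_gt0 : (0 < #|B|)%N by rewrite card_gt0; apply/set0Pn; exists u.
have e1 x y : [rel x y in S | adj G x y] x y -> 1 <= A x y.
  by move=> /= /andP[_]; rewrite ler1n.
have esym : symmetric [rel x y in S | adj G x y].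
  by move=> x y /=; rewrite [(x \in S) && _]andbC /adj /= mult_sym.
have A0 x y : 0 <= A x y by [].
have := dirichlet_energy_path f A0 e1 esym wp up pS.
move=> /le_trans /(_ (ler_wpM2l (ler0n _ _) energy)).
have -> (L X : R) : L * (2 * X) = 2 * (L * X) by ring.
rewrite ler_pM2l // -/M => drop.
(* The path ends in [B], where $f \le m \le M$; [fluxle] then eliminates $1 - \lambda$. *)
have {}drop : (M - m) ^+ 2 <= (size p)%:R * (M * (De * #|B|%:R * m)).
  apply: le_trans (_ : (M - f (last w p)) ^+ 2 <= _).
    by rewrite lerXn2r ?nnegrE ?subr_ge0 //
      ?lerD2l ?lerN2 ?wmax ?umax // pS ?mem_last.
  apply: le_trans drop _; rewrite ler_wpM2l // mulrCA ler_wpM2l //.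
  by rewrite ltW // fpos.
have LB : 4 * ((size p)%:R * #|B|%:R) <= #|S|%:R ^+ 2 :> R.
  rewrite -natrX -!natrM ler_nat.
  by rewrite (leq_trans (nat_AGM2 _ _)) ?leq_exp2r.
(* Both [p] and [B] are nonempty, so [S] has at least two vertices. *)
have k4 : 4 <= #|S|%:R ^+ 2 :> R.
  by rewrite -natrX ler_nat (@leq_exp2r 2 _ 2) // (leq_trans _ size_p) //
    (@leq_add 1 1).
have M0 : 0 < M by apply: fpos.
have drop4 : 4 * (M - m) ^+ 2 <= M * (De * #|S|%:R ^+ 2 * m).
  have -> : M * (De * #|S|%:R ^+ 2 * m) = M * De * m * #|S|%:R ^+ 2 by ring.
  apply: le_trans (_ : M * De * m * (4 * ((size p)%:R * #|B|%:R)) <= _).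
    have -> : M * De * m * (4 * ((size p)%:R * #|B|%:R)) =
      4 * ((size p)%:R * (M * (De * #|B|%:R * m))) by ring.
    by rewrite ler_pM2l.
  by rewrite ler_wpM2l // !mulr_ge0 ?(ltW m0) ?(ltW M0).
have Z4 : 4 * m <= De * #|S|%:R ^+ 2 * m.
  rewrite ler_pM2r // -[leLHS]mul1r ler_pM //.
move: drop4 Z4; move: (De * _ * m) => Z drop4 Z4.
(* If $Z < M$, then $2(M-m) < M$, so $M < 2m$, against $4m \le Z < M$. *)
rewrite leNgt; apply/negP => ZM.
have : 4 * (M - m) ^+ 2 < M ^+ 2.
  by apply: le_lt_trans drop4 _; rewrite expr2 ltr_pM2l.
nra.
Qed.

(** * Passage to the Perron vector and the final estimate *)

Lemma principal_normadjmxE (R : realType) (V : finType) (G : multigraph V)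
    (S : {set V}) (i j : 'I_#|S|) :
  principal_submx (normadjmx R G) S i j =
    (mult G (enum_val i) (enum_val j))%:R /
      (Num.sqrt (degree G (enum_val i))%:R *
       Num.sqrt (degree G (enum_val j))%:R).
Proof.
rewrite /principal_submx /normadjmx /inv_sqrt_degmx mul_diag_mx mul_mx_diag.
by rewrite !mxE !enum_rankK invfM; ring.
Qed.

Theorem theorem1p4 (R : realType) (V : finType) (G : multigraph V)
    (S : {set V}) (lambda1 : R) (psi : 'cV[R]_#|S|)
    (G_connected : connected_graph G)
    (S_proper : S \proper [set: V]%SET)
    (S_connected : induced_connected G S)
    (lambda1_def : largest_eigenvalue (principal_submx (normadjmx R G) S) lambda1)
    (lambda1_gt0 : 0 < lambda1)
    (psi_def : perron_vector (principal_submx (normadjmx R G) S) psi) :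
  exists (u : V) (uS : u \in S),
    (exists2 v : V, v \notin S & adj G u v) /\
    psi (enum_rank_in uS u) 0 >=
      1 / ((max_degree G)%:R `^ (5 / 2) * lambda1 * #|S|%:R `^ (5 / 2)).
Proof.
have [psi_gt0 psi_unit [a a_def psiE]] := psi_def.
have aE : a = lambda1.
  by apply/le_anti; rewrite (a_def.2 _ lambda1_def.1) (lambda1_def.2 _ a_def.1).
rewrite {}aE in psiE; clear a a_def.
have [S0 _] := S_connected; have /set0Pn[s sS] := S0.
pose r := enum_rank_in sS.
have rE i : r (enum_val i) = i by apply: enum_valK_in.
have rK : {in S, cancel r enum_val} by apply: enum_rankK_in.
pose d v : R := (degree G v)%:R.
have d0 v : 0 <= d v by [].
have sumS (F : 'I_#|S| -> R) : \sum_i F i = \sum_(v in S) F (r v).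
  by rewrite (big_enum_rank sS).
have eqn u : u \in S -> lambda1 * psi (r u) 0 =
    \sum_(v in S) (mult G u v)%:R / (Num.sqrt (d u) * Num.sqrt (d v)) *
      psi (r v) 0.
  move=> uS; have := congr1 (fun x : 'cV_#|S| => x (r u) 0) psiE.
  rewrite !mxE => <-.
  rewrite sumS; apply: eq_bigr => v vS.
  by rewrite principal_normadjmxE !rK.
(* As the inverse of 0 is 0, degree 0 would give a zero row, against the positivity of [lambda1] and
   [psi]. *)
have sq0 u : u \in S -> 0 < Num.sqrt (d u).
  move=> uS; rewrite lt_neqAle sqrtr_ge0 andbT; apply/eqP => su0.
  have := mulr_gt0 lambda1_gt0 (psi_gt0 (r u)).
  rewrite eqn // big1 ?ltxx // => v _.
  by rewrite -su0 mul0r invr0 mulr0 mul0r.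
pose f u := psi (r u) 0 / Num.sqrt (d u).
have f_gt0 u : u \in S -> 0 < f u by move=> uS; rewrite divr_gt0 ?sq0.
have fE u : u \in S -> lambda1 * (degree G u)%:R * f u =
    \sum_(v in S) (mult G u v)%:R * f v.
  move=> uS; have su := sq0 u uS.
  have -> : lambda1 * (degree G u)%:R * f u =
      lambda1 * psi (r u) 0 * Num.sqrt (d u).
    rewrite -[(degree G u)%:R](sqr_sqrtr (d0 u)) /f; field.
    by rewrite gt_eqF.
  rewrite eqn // mulr_suml; apply: eq_bigr => v vS.
  have sv := sq0 v vS; rewrite /f; field.
  by rewrite !gt_eqF.
have [u uB fu] :=
  eigenfunction_boundary_max G_connected S_proper S_connected f_gt0 fE.
move: (uB); rewrite inE => /andP[uS /existsP[v /andP[vS uv]]].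
exists u, uS; split; first by exists v.
have -> : enum_rank_in uS u = r u.
  by apply: enum_val_inj; rewrite enum_rankK_in ?rK.
set De : R := (max_degree G)%:R; set k : R := #|S|%:R.
have dDe v' : d v' <= De by rewrite ler_nat (leq_bigmax v').
have d1 x : x \in S -> 1 <= d x.
  by move=> xS; rewrite ler1n lt0n; have := sq0 x xS; apply: contraTneq;
     rewrite /d => ->; rewrite sqrtr0 ltxx.
have De1 : 1 <= De := le_trans (d1 u uS) (dDe u).
have k1 : 1 <= k by rewrite ler1n card_gt0.
(* At a minimum [y] of [f], $\lambda_1 d(y)$ is at least the number of edges from [y] into [S], an
   integer that is nonzero because the right side of [fE] is positive. *)
have lamDe : 1 <= lambda1 * De.
  case: (arg_minP f sS) => y yS ymin.
  have fy := f_gt0 y yS.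
  have : 0 < \sum_(v in S) (mult G y v)%:R * f v.
    rewrite -fE //; apply: mulr_gt0 => //; apply: mulr_gt0 => //.
    by apply: lt_le_trans (d1 y yS).
  have dS : (\sum_(v in S) mult G y v)%:R * f y <=
      \sum_(v in S) (mult G y v)%:R * f v.
    rewrite natr_sum mulr_suml; apply: ler_sum => z zS.
    by rewrite ler_wpM2l //; exact: ymin.
  move=> s0; have s1 : 1 <= (\sum_(v in S) mult G y v)%:R :> R.
    rewrite ler1n lt0n; apply: contraTneq s0 => /eqP; rewrite sum_nat_eq0.
    move=> /forall_inP m0; rewrite big1 ?ltxx // => z zS.
    by rewrite (eqP (m0 z zS)) mul0r.
  apply: le_trans (_ : lambda1 * d y <= _); last by rewrite ler_pM2l.
  by rewrite -(ler_pM2r fy) fE // (le_trans _ dS) // ler_pM2r.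
pose M := f [arg max_(w > s in S) f w]%O.
have fM w : w \in S -> f w <= M.
  by rewrite /M; case: arg_maxP => // y yS ymax /ymax.
have M0 : 0 < M by apply: lt_le_trans (fM s sS); apply: f_gt0.
have MB : M <= De * k ^+ 2 * f u.
  by rewrite /M; case: arg_maxP => // y yS _; apply: fu.
(* The unit norm reads $\sum_S d f^2 = 1$, and each term is at most $\Delta M^2$. *)
have norm1 : 1 <= De * k * M ^+ 2.
  have /(congr1 (fun x => x ^+ 2)) := psi_unit.
  rewrite expr1n sqr_sqrtr ?sumr_ge0 // => [<-|i _]; last exact: sqr_ge0.
  have -> : De * k * M ^+ 2 = \sum_(v in S) De * M ^+ 2.
    by rewrite sumr_const -mulr_natr mulrAC.
  rewrite sumS; apply: ler_sum => z zS.
  have -> : psi (r z) 0 = Num.sqrt (d z) * f z.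
    by rewrite /f mulrC divfK // gt_eqF // sq0.
  rewrite exprMn sqr_sqrtr // ler_pM ?sqr_ge0 ?dDe //.
  by rewrite lerXn2r ?nnegrE ?fM // ltW // f_gt0.
have psif : f u <= psi (r u) 0.
  rewrite /f ler_pdivrMr ?sq0 // ler_peMr ?(ltW (psi_gt0 _)) //.
  by rewrite -[leLHS]sqrtr1; exact: ler_wsqrtr (d1 u uS).
have pow52 (x : R) : 1 <= x -> x `^ (5 / 2) = x ^+ 2 * Num.sqrt x.
  move=> x1; have -> : (5 / 2 : R) = 2 + 2^-1 by field.
  by rewrite powRD ?(gt_eqF (lt_le_trans ltr01 x1)) ?implybT //
    powR12_sqrt ?powR_mulrn
    ?(le_trans ler01).
rewrite !pow52 //; apply: le_trans psif.
have fu0 := f_gt0 u uS.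
have De0 := lt_le_trans ltr01 De1; have k0 := lt_le_trans ltr01 k1.
have De_sqrt0 : 0 < Num.sqrt De by rewrite sqrtr_gt0.
have k_sqrt0 : 0 < Num.sqrt k by rewrite sqrtr_gt0.
have stM : 1 <= Num.sqrt De * Num.sqrt k * M.
  have := ler_wsqrtr norm1.
  rewrite sqrtr1 (@sqrtrM _ (De * k)) ?(mulr_ge0 (ltW De0) (ltW k0)) //.
  by rewrite sqrtr_sqr (gtr0_norm M0) sqrtrM // ltW.
rewrite ler_pdivrMr ?mulr_gt0 ?exprn_gt0 //.
(* Both factors are at least 1: the first by [lamDe], the second by [stM] and [MB]. *)
have -> : f u * (De ^+ 2 * Num.sqrt De * lambda1 * (k ^+ 2 * Num.sqrt k)) =
    (lambda1 * De) * (Num.sqrt De * Num.sqrt k * (De * k ^+ 2 * f u)) by ring.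
rewrite mulr_ege1 // (le_trans stM) // ler_wpM2l // mulr_ge0 ?ltW //.
Qed.
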